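(* Let $k\ge1$, let $D_k\subset\mathbb{R}^5$ be as in the context, and assume $D_k$ is simplicial. Let $F$ be a facet of $D_k$ other than $D_k^-,D_k^+$ such that $E=F\cap D_k^-$ is an edge (1-dimensional face) of $D_k^-$. Then $E=g\big(\tau(\mathrm{conv}\{a_i,a_{i+1}\})\big)$ for some $g\in\Gamma^+$ and some $1\le i\le k$.
   Context: Fix an integer $k\ge 1$ and real numbers $(x_i,y_i)$, $1\le i\le k+1$, with $(x_1,y_1)=(100,0)$ and $(x_{k+1},y_{k+1})=(75,75)$, satisfying: (A1) $100=x_1>x_2>\dots>x_{k+1}=75$ and $0=y_1<\dots<y_{k+1}=75$; (A2) the points $(x_i,y_i)$ are in convex position in $\mathbb{R}^2$; (A3) for each $1\le i\le k$, the line through $(x_i,y_i)$ and $(x_{i+1},y_{i+1})$ meets the $x$-axis at $(u,0)$ with $100\le u\le 102$. In $\mathbb{R}^5$ let $m_{\pm\pm}=(0,0,\pm 3,\pm 3,1)$ (four points), $p_\pm=(98,0,\pm1,0,1)$, $a_i=(x_i,y_i,0,0,1)$. Let $\varepsilon_j$ ($1\le j\le 5$) change the sign of the $j$-th coordinate, $\tau(v_1,\dots,v_5)=(v_4,v_3,v_1,v_2,-v_5)$, $\sigma=\tau^2$, $\Gamma=\langle\tau,\varepsilon_1,\dots,\varepsilon_4\rangle$, $\Gamma^+=\langle\sigma,\varepsilon_1,\dots,\varepsilon_4\rangle$, and $D_k=\mathrm{conv}\{g(v):g\in\Gamma, v\in\{m_{\pm\pm},p_\pm,a_1,\dots,a_{k+1}\}\}$,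 a drum with skins $D_k^\pm=D_k\cap\{v_5=\pm1\}$; it is simplicial if every facet other than $D_k^\pm$ is a simplex. *)

(* Defs.v *)
From HB Require Import structures.
From mathcomp Require Import all_boot all_order all_algebra.
From mathcomp Require Import classical_sets reals.

Set Implicit Arguments.
Unset Strict Implicit.
Unset Printing Implicit Defensive.

Import Order.TTheory GRing.Theory Num.Theory.
Local Open Scope classical_set_scope.
Local Open Scope ring_scope.

Definition conv (R : realType) (n : nat) (A : set 'rV[R]_n) : set 'rV[R]_n :=
  [set v | exists (N : nat) (w : 'I_N -> R) (p : 'I_N -> 'rV[R]_n),
     [/\ forall i, A (p i), forall i, 0 <= w i, \sum_i w i = 1
       & v = \sum_i w i *: p i]].

Definition aff (R : realType) (n : nat) (A : set 'rV[R]_n) : set 'rV[R]_n :=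
  [set v | exists (N : nat) (w : 'I_N -> R) (p : 'I_N -> 'rV[R]_n),
     [/\ forall i, A (p i), \sum_i w i = 1 & v = \sum_i w i *: p i]].

(* The dimension of a set is that of its affine hull; the empty set has none. *)
Definition has_dim (R : realType) (n : nat) (A : set 'rV[R]_n) (d : nat) : Prop :=
  exists (p : 'rV[R]_n) (U : {vspace 'rV[R]_n}),
    aff A = [set v | v - p \in U] /\ \dim U = d.

(* Faces are cut out by valid linear inequalities, so set0 and P are faces. *)
Definition face (R : realType) (n : nat) (P F : set 'rV[R]_n) : Prop :=
  exists (c : 'rV[R]_n) (b : R),
    (forall v, P v -> \sum_j c 0 j * v 0 j <= b) /\
    F = P `&` [set v | \sum_j c 0 j * v 0 j = b].

Definition facet (R : realType) (n : nat) (P F : set 'rV[R]_n) : Prop :=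
  face P F /\ exists d : nat, has_dim P d.+1 /\ has_dim F d.

Definition edge (R : realType) (n : nat) (P E : set 'rV[R]_n) : Prop :=
  face P E /\ has_dim E 1.

Definition affinely_independent (R : realType) (n N : nat)
    (p : 'I_N -> 'rV[R]_n) : Prop :=
  forall w : 'I_N -> R,
    \sum_i w i = 0 -> \sum_i w i *: p i = 0 -> forall i, w i = 0.

Definition simplex (R : realType) (n : nat) (S : set 'rV[R]_n) : Prop :=
  exists (d : nat) (p : 'I_d.+1 -> 'rV[R]_n),
    affinely_independent p /\ S = conv (range p).

Definition convex_position (R : realType) (n : nat) (A : set 'rV[R]_n) : Prop :=
  forall p, A p -> ~ conv (A `\ p) p.

(* The group of bijections of V generated by S. *)
Inductive generated (V : Type) (S : set (V -> V)) : (V -> V) -> Prop :=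
| generated_in f : S f -> generated S f
| generated_id : generated S id
| generated_comp f g : generated S f -> generated S g -> generated S (f \o g)
| generated_inv f g :
    generated S f -> cancel f g -> cancel g f -> generated S g.

Definition vec2 (R : realType) (a b : R) : 'rV[R]_2 := \row_j [:: a; b]`_j.

Definition vec5 (R : realType) (a b c d e : R) : 'rV[R]_5 :=
  \row_j [:: a; b; c; d; e]`_j.

(* Coordinates are numbered from 1: [crd v j] is v_j for 1 <= j <= 5. *)
Definition crd (R : realType) (v : 'rV[R]_5) (j : nat) : R := v 0 (inord j.-1).

Definition eps (R : realType) (j : nat) (v : 'rV[R]_5) : 'rV[R]_5 :=
  \row_(i < 5) (if i.+1 == j then - v 0 i else v 0 i).

Definition tau (R : realType) (v : 'rV[R]_5) : 'rV[R]_5 :=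
  vec5 (crd v 4) (crd v 3) (crd v 1) (crd v 2) (- crd v 5).

Definition sigma (R : realType) (v : 'rV[R]_5) : 'rV[R]_5 := tau (tau v).

Definition sign_changes (R : realType) : set ('rV[R]_5 -> 'rV[R]_5) :=
  [set @eps R j | j in [set j | (1 <= j <= 4)%N]].

Definition Gamma (R : realType) : set ('rV[R]_5 -> 'rV[R]_5) :=
  generated ([set @tau R] `|` @sign_changes R).

Definition Gamma_plus (R : realType) : set ('rV[R]_5 -> 'rV[R]_5) :=
  generated ([set @sigma R] `|` @sign_changes R).

(* Only the values of x and y at the indices 1, ..., k+1 are used. *)
Definition planar_points (R : realType) (k : nat) (x y : nat -> R) : set 'rV[R]_2 :=
  [set vec2 (x i) (y i) | i in [set i | (1 <= i <= k.+1)%N]].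

(* The line through two distinct points is their affine hull. *)
Record admissible (R : realType) (k : nat) (x y : nat -> R) : Prop := Admissible {
  adm_first : x 1%N = 100 /\ y 1%N = 0;
  adm_last : x k.+1 = 75 /\ y k.+1 = 75;
  adm_mono : forall i, (1 <= i <= k)%N -> x i.+1 < x i /\ y i < y i.+1;
  adm_convex : convex_position (planar_points k x y);
  adm_lines : forall i, (1 <= i <= k)%N -> exists u : R,
    100 <= u <= 102 /\
    aff [set vec2 (x i) (y i); vec2 (x i.+1) (y i.+1)] (vec2 u 0)
}.

(* The booleans s and t range over the choices of signs. *)
Definition pt_m (R : realType) (s t : bool) : 'rV[R]_5 :=
  vec5 0 0 ((-1) ^+ s * 3) ((-1) ^+ t * 3) 1.

Definition pt_p (R : realType) (s : bool) : 'rV[R]_5 :=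
  vec5 98 0 ((-1) ^+ s) 0 1.

Definition pt_a (R : realType) (x y : nat -> R) (i : nat) : 'rV[R]_5 :=
  vec5 (x i) (y i) 0 0 1.

Definition base_points (R : realType) (k : nat) (x y : nat -> R) : set 'rV[R]_5 :=
  [set v | (exists s t, v = pt_m R s t) \/ (exists s, v = pt_p R s) \/
           (exists2 i, (1 <= i <= k.+1)%N & v = pt_a x y i)].

Definition drum (R : realType) (k : nat) (x y : nat -> R) : set 'rV[R]_5 :=
  conv [set g v | g in @Gamma R & v in base_points k x y].

Definition skin_plus (R : realType) (k : nat) (x y : nat -> R) : set 'rV[R]_5 :=
  drum k x y `&` [set v | crd v 5 = 1].

Definition skin_minus (R : realType) (k : nat) (x y : nat -> R) : set 'rV[R]_5 :=
  drum k x y `&` [set v | crd v 5 = -1].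

Definition simplicial_drum (R : realType) (k : nat) (x y : nat -> R) : Prop :=
  forall F, facet (drum k x y) F ->
    F <> skin_plus k x y -> F <> skin_minus k x y -> simplex F.

(* Main.v *)
Require Import Defs.
From HB Require Import structures.
From mathcomp Require Import all_boot all_order all_algebra.
From mathcomp Require Import boolp classical_sets reals.
From mathcomp Require Import ring lra.

Import Order.TTheory GRing.Theory Num.Theory.
Local Open Scope classical_set_scope.
Local Open Scope ring_scope.

(** Let [c] be the normal of [F], so that [E] and the upper part of [F] are the
faces of the two skins on which [c] is maximal.  Comparing the values of [c] at
the orbits of the m's, of the p's, of [a_1] and of [a_(k+1)] shows that [c]
cannot be maximal at vertices outside the polygon spanned by the a's in both
skins at once.  If [E] had such a vertex, the upper part of [F] would therefore
lie on a line of the plane of the upper polygon, whence [dim F <= 3], whereas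
[dim F = 4].  So [E] is an edge of the lower polygon.  Conditions (A2) and (A3)
make the slopes along the chain of the a's strictly monotone and [x_i + y_i]
strictly increasing, so the edges of the polygon are the images of the segments
[a_i a_(i+1)]. *)

(** * Convex and affine hulls *)

Section Hulls.
Context {R : realType} {n : nat}.
Implicit Types (A B : set 'rV[R]_n) (c v q : 'rV[R]_n) (U W : {vspace 'rV[R]_n}).

Definition dot c v : R := \sum_j c 0 j * v 0 j.

Lemma dot_sum c N (w : 'I_N -> R) (p : 'I_N -> 'rV[R]_n) :
  dot c (\sum_i w i *: p i) = \sum_i w i * dot c (p i).
Proof.
rewrite /dot; under eq_bigr => j _ do rewrite summxE mulr_sumr.
rewrite exchange_big /=; apply: eq_bigr => i _; rewrite mulr_sumr.
by apply: eq_bigr => j _; rewrite mxE mulrCA.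
Qed.

Lemma sub_conv A : A `<=` conv A.
Proof.
move=> v Av; exists 1%N, (fun=> 1), (fun=> v); split=> //.
- by rewrite big_ord1.
- by rewrite big_ord1 scale1r.
Qed.

Lemma sub_aff A : A `<=` aff A.
Proof.
move=> v Av; exists 1%N, (fun=> 1), (fun=> v); split=> //.
- by rewrite big_ord1.
- by rewrite big_ord1 scale1r.
Qed.

Lemma conv_mono A B : A `<=` B -> conv A `<=` conv B.
Proof.
by move=> AB v [N [w [p [Ap w0 w1 ->]]]]; exists N, w, p; split=> // i; apply: AB.
Qed.

Lemma conv3 A (p q r : 'rV[R]_n) (a b c : R) :
    A p -> A q -> A r -> 0 <= a -> 0 <= b -> 0 <= c -> a + b + c = 1 ->
  conv A (a *: p + b *: q + c *: r).
Proof.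
move=> Ap Aq Ar a0 b0 c0 abc.
exists 3%N, (fun i => [:: a; b; c]`_i), (fun i => nth 0 [:: p; q; r] i).
split.
- by case; case=> [|[|[|]]].
- by case; case=> [|[|[|]]].
- by rewrite !big_ord_recl big_ord0 /= addr0 addrA.
- by rewrite !big_ord_recl big_ord0 /= addr0 addrA.
Qed.

Lemma conv_sub_aff A : conv A `<=` aff A.
Proof. by move=> v [N [w [p [Ap w0 w1 ->]]]]; exists N, w, p. Qed.

Lemma conv_dot_eq A c b v :
  (forall u, A u -> dot c u = b) -> conv A v -> dot c v = b.
Proof.
move=> Ab [N [w [p [Ap w0 w1 ->]]]]; rewrite dot_sum -[b]mul1r -w1 mulr_suml.
by apply: eq_bigr => i _; rewrite Ab.
Qed.

(** The weighted gaps [w i * (b - dot c (p i))] are nonnegative and sum to zero, so every point of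
    nonzero weight lies on the hyperplane. *)
Lemma conv_face A c b v :
    (forall u, A u -> dot c u <= b) -> conv A v -> dot c v = b ->
  conv (A `&` [set u | dot c u = b]) v.
Proof.
move=> Ab [N [w [p [Ap w0 w1 vE]]]] vb.
have gap0 i : w i * (b - dot c (p i)) = 0.
  have ge0 j : 0 <= w j * (b - dot c (p j)) by rewrite mulr_ge0 // subr_ge0 Ab.
  have : \sum_j w j * (b - dot c (p j)) = 0.
    under eq_bigr => j _ do rewrite mulrBr.
    by rewrite sumrB -mulr_suml w1 mul1r -dot_sum -vE vb subrr.
  by move/psumr_eq0P => /(_ (fun j _ => ge0 j)) /(_ i isT).
have act i : w i != 0 -> dot c (p i) = b.
  move=> wi; have /eqP := gap0 i; rewrite mulf_eq0 (negPf wi) /= subr_eq0.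
  by move/eqP.
have [i0 wi0] : exists i0, w i0 != 0.
  apply/existsP; rewrite -negb_forall; apply/negP => /forallP wz.
  have := w1; rewrite big1 => [/eqP|i _]; first by rewrite eq_sym oner_eq0.
  exact/eqP.
(* Points of weight zero may miss the hyperplane; the active point [p i0] takes their place. *)
exists N, w, (fun i => if w i == 0 then p i0 else p i); split=> //.
- by move=> i; case: eqVneq => [_|/act] /=; split=> //; apply: act.
- rewrite vE; apply: eq_bigr => i _; case: eqVneq => // ->.
  by rewrite !scale0r.
Qed.

Lemma aff_sub_flat A q W :
  (forall v, A v -> v - q \in W) -> forall v, aff A v -> v - q \in W.
Proof.
move=> AW _ [N [w [p [Ap w1 ->]]]].
have -> : \sum_i w i *: p i - q = \sum_i w i *: (p i - q).
  under [RHS]eq_bigr => i _ do rewrite scalerBr.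
  by rewrite sumrB -scaler_suml w1 scale1r.
by apply: rpred_sum => i _; apply: rpredZ; apply: AW.
Qed.

(** The direction space [U] of the hull lies in [W]: each [u] in [U] is the difference of
    [p + u - q] and [p - q], both in [W]. *)
Lemma dim_flat_le A q W d :
  has_dim A d -> (forall v, A v -> v - q \in W) -> (d <= \dim W)%N.
Proof.
move=> [p [U [AU <-]]] AW; apply: dimvS; apply/subvP => u uU.
have inW v : v - p \in U -> v - q \in W.
  by move=> vU; apply: (aff_sub_flat _ _ _ AW); rewrite AU.
have -> : u = (p + u - q) - (p - q) by rewrite opprB addrA subrK addrC addKr.
apply: rpredB; apply: inW; last by rewrite subrr mem0v.
by rewrite addrC addKr.
Qed.

Lemma dim1_not_sub1 A q : has_dim A 1 -> ~ (A `<=` [set q]).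
Proof.
move=> dA Aq; suff: (1 <= \dim (0%VS : {vspace 'rV[R]_n}))%N by rewrite dimv0.
by apply: (dim_flat_le _ q _ _ dA) => v /Aq ->; rewrite subrr mem0v.
Qed.

End Hulls.

(** * The polygonal chain *)

Section Chain.
Context {R : realType} {k : nat} {x y : nat -> R}.
Hypothesis k_ge1 : (1 <= k)%N.
Hypothesis adm : admissible k x y.

Let incr_seq (f : nat -> R) (m i j : nat) :
  (forall i, (1 <= i < m)%N -> f i < f i.+1) ->
  (1 <= i)%N -> (i < j <= m)%N -> f i < f j.
Proof.
move=> fS i1 /andP[]; elim: j => // j IH; rewrite ltnS leq_eqVlt.
case/predU1P => [<- im|ij jm]; first by apply: fS; rewrite i1.
apply: (lt_trans (IH ij (ltnW jm))); apply: fS.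
by rewrite jm (leq_trans i1 (ltnW ij)).
Qed.

Lemma y_incr i j : (1 <= i)%N -> (i < j <= k.+1)%N -> y i < y j.
Proof. by apply: incr_seq => l lk; case: (adm_mono adm lk). Qed.

Lemma x_decr i j : (1 <= i)%N -> (i < j <= k.+1)%N -> x j < x i.
Proof.
move=> i1 ij; rewrite -ltrN2; apply: (incr_seq (fun i => - x i)) i1 ij.
by move=> l lk; rewrite ltrN2; case: (adm_mono adm lk).
Qed.

Lemma y_ge0 i : (1 <= i <= k.+1)%N -> 0 <= y i.
Proof.
have [_ <-] := adm_first adm; case/andP; rewrite leq_eqVlt.
by case/predU1P => [<- //|i1 ik]; apply/ltW/y_incr; rewrite ?i1.
Qed.

Lemma x_ge75 i : (1 <= i <= k.+1)%N -> 75 <= x i.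
Proof.
have [<- _] := adm_last adm; case/andP=> i1; rewrite leq_eqVlt.
by case/predU1P => [-> //|ik]; apply/ltW/x_decr => //; rewrite ik /=.
Qed.

Lemma y_lt_x i : (1 <= i <= k)%N -> y i < x i.
Proof.
case/andP=> i1 ik; apply: (@lt_le_trans _ _ 75).
  by have [_ <-] := adm_last adm; apply: y_incr; rewrite ?ltnS ?ik /=.
by apply: x_ge75; rewrite i1 leqW.
Qed.

(** * Slopes along the chain *)

(* The i-th line is [X + slope i * Y = u_i], hence meets the axis at [u_i]. *)
Definition slope i := (x i - x i.+1) / (y i.+1 - y i).

Lemma slopeE i : (1 <= i <= k)%N -> x i - x i.+1 = slope i * (y i.+1 - y i).
Proof.
by move=> ik; have [_ yi] := adm_mono adm ik; rewrite /slope divfK // subr_eq0 gt_eqF.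
Qed.

Lemma vec2E (a b : R) : (vec2 a b 0 0 = a) * (vec2 a b 0 1 = b).
Proof. by rewrite !mxE. Qed.

(** The form [X + slope i * Y] is constant on the line through the two points, so it equals its
    value [u] at the crossing with the axis. *)
Lemma slope_bounds i :
  (1 <= i <= k)%N -> 100 <= x i + slope i * y i <= 102.
Proof.
move=> ik; have [u [u_le [N [w [p [pP w1 uE]]]]]] := adm_lines adm ik.
suff -> : x i + slope i * y i = u by [].
have val j : (p j) 0 0 + slope i * (p j) 0 1 = x i + slope i * y i.
  case: (pP j) => ->; rewrite !vec2E //.
  by have := slopeE _ ik; lra.
have: (vec2 u 0) 0 0 + slope i * (vec2 u 0) 0 1 =
      \sum_j w j * ((p j) 0 0 + slope i * (p j) 0 1).
  rewrite uE !summxE mulr_sumr -big_split; apply: eq_bigr => j _ /=.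
  by rewrite !mxE; ring.
under eq_bigr => j _ do rewrite val.
by rewrite -mulr_suml w1 mul1r !vec2E mulr0 addr0.
Qed.

(* If the slopes did not increase at p_{i+1}, then p_i and p_1 would lie weakly
   on opposite sides of the line p_{i+1} p_{i+2}, putting p_{i+1} inside the
   triangle p_1 p_i p_{i+2}. *)
Lemma slope_step i : (1 <= i < k)%N -> slope i < slope i.+1.
Proof.
case/andP=> i1 ik; rewrite ltNge; apply/negP => sle.
have si := slopeE i; have sj := slopeE i.+1; have bj := slope_bounds i.+1.
have {si} si := si ltac:(by rewrite i1 ltnW).
have {sj} sj := sj ltac:(by rewrite ik).
have {bj} /andP[bj _] := bj ltac:(by rewrite ik).
have yij : y i < y i.+1 by apply: y_incr; rewrite ?ltnSn //= leqW.
have yjl : y i.+1 < y i.+2 by apply: y_incr; rewrite ?ltnSn //=.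
have y1j : y 1%N < y i.+1 by apply: y_incr; rewrite //= ltnS i1 leqW.
have yi0 : 0 <= y i by apply: y_ge0; rewrite i1 leqW // ltnW.
have [x1E y1E] := adm_first adm; rewrite y1E in y1j.
set s := slope i in sle si; set t := slope i.+1 in sle sj bj.
(* The point [mu *: p_i + (1 - mu) *: p_1] is to lie on the line p_{i+1} p_{i+2}. Compared with its
   value on that line, [X + t * Y] is larger by [al] at p_i and smaller by [be] at p_1; (A3) gives
   [0 <= be]. *)
have [mu [mu0 mu1 muE]] : exists mu : R, [/\ 0 <= mu, mu <= 1 &
    mu * ((s - t) * (y i.+1 - y i)) = (1 - mu) * (x i.+1 + t * y i.+1 - 100)].
  set al := (s - t) * _; set be := x i.+1 + _ - 100.
  have al0 : 0 <= al by rewrite /al mulr_ge0 // subr_ge0 // ltW.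
  have be0 : 0 <= be by rewrite /be; lra.
  case: (eqVneq al 0) => [->|aln].
    by exists 1; split; rewrite ?ler01 // subrr mulr0 mul0r.
  have ab : 0 < al + be by rewrite ltr_wpDr // lt_neqAle eq_sym aln.
  exists (be / (al + be)); split.
  - by rewrite divr_ge0 // ltW.
  - by rewrite ler_pdivrMr // mul1r lerDr.
  - by field; rewrite gt_eqF.
have ylt : 0 < y i.+2 - mu * y i.
  have : mu * y i <= y i by rewrite ler_piMl.
  by lra.
(* This weight makes the second coordinates agree, given that [y 1] is 0. *)
pose la := (y i.+2 - y i.+1) / (y i.+2 - mu * y i).
have la0 : 0 <= la by rewrite divr_ge0 ?ltW // subr_gt0.
have la1 : la <= 1.
  rewrite ler_pdivrMr // mul1r; have : mu * y i <= y i by rewrite ler_piMl.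
  by lra.
have laE : la * (y i.+2 - mu * y i) = y i.+2 - y i.+1.
  by rewrite divfK // gt_eqF.
pose pp l := vec2 (x l) (y l).
have in_pts l : (1 <= l <= k.+1)%N -> y l != y i.+1 ->
    (planar_points k x y `\ pp i.+1) (pp l).
  move=> lk yl; split; first by exists l.
  move=> /matrixP /(_ 0 1); rewrite !vec2E => yE.
  by rewrite yE eqxx in yl.
have /(adm_convex adm) : planar_points k x y (pp i.+1).
  by exists i.+1 => //=; rewrite ltnW.
apply.
have ppE : pp i.+1 =
    (la * mu) *: pp i + (la * (1 - mu)) *: pp 1%N + (1 - la) *: pp i.+2.
  have Yeq : y i.+1 = la * mu * y i + la * (1 - mu) * y 1%N + (1 - la) * y i.+2.
    by rewrite y1E; lra.
  apply/rowP; case; case=> [|[|//]] h.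
    rewrite !mxE /=; rewrite -/(x i.+1) x1E.
    have xi : x i = x i.+1 + s * (y i.+1 - y i) by lra.
    have xl : x i.+2 = x i.+1 - t * (y i.+2 - y i.+1) by lra.
    have : la * (mu * ((s - t) * (y i.+1 - y i))) =
        la * ((1 - mu) * (x i.+1 + t * y i.+1 - 100)).
      by rewrite muE.
    have : t * (la * (y i.+2 - mu * y i)) = t * (y i.+2 - y i.+1) by rewrite laE.
    by rewrite xi xl; lra.
  by rewrite !mxE /= -/(y i.+1).
rewrite {2}ppE; apply: conv3; last by ring.
- by apply: in_pts; rewrite ?i1 ?lt_eqF //= leqW // ltnW.
- by apply: in_pts; rewrite ?y1E ?lt_eqF.
- by apply: in_pts; rewrite ?gt_eqF.
- exact: mulr_ge0.
- by rewrite mulr_ge0 // subr_ge0.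
- by rewrite subr_ge0.
Qed.

Lemma slope_incr i j : (1 <= i)%N -> (i < j <= k)%N -> slope i < slope j.
Proof. exact: incr_seq slope_step. Qed.

(** The last line passes through (75, 75), so its crossing [75 + 75 * slope k] is at most 102; the
    earlier slopes are smaller still. Slopes below 1 mean that [x i + y i] increases strictly. *)
Lemma slope_lt1 i : (1 <= i <= k)%N -> slope i < 1.
Proof.
have sk : slope k < 1.
  have kk : (1 <= k <= k)%N by rewrite k_ge1 /=.
  have := slopeE _ kk; have /andP[_] := slope_bounds _ kk.
  by have [-> ->] := adm_last adm; lra.
case/andP=> i1; rewrite leq_eqVlt => /predU1P[-> //|ik].
by apply: lt_trans (slope_incr _ _ i1 _) sk; rewrite ik /=.
Qed.

(** The a-points in the plane of one skin: the orbit of the chain under sign changes and the swap of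
    the two coordinates. *)
Definition polygon (X Y : R) := exists (s t : bool) (i : nat),
  (1 <= i <= k.+1)%N /\
  ((X = (-1) ^+ s * x i /\ Y = (-1) ^+ t * y i) \/
   (X = (-1) ^+ s * y i /\ Y = (-1) ^+ t * x i)).

Lemma polygonS X Y : polygon X Y -> polygon Y X.
Proof.
by move=> [s [t [i [ik [[-> ->]|[-> ->]]]]]]; exists t, s, i; split=> //; [right|left].
Qed.

Lemma polygonN X Y : polygon X Y -> polygon (- X) Y.
Proof.
move=> [s [t [i [ik XY]]]]; exists (~~ s), t, i; split=> //.
by rewrite signrN !mulNr; case: XY => [[-> ->]|[-> ->]]; [left|right].
Qed.

Lemma polygon_vertex i : (1 <= i <= k.+1)%N -> polygon (x i) (y i).
Proof. by move=> ik; exists false, false, i; split=> //; left; rewrite !mul1r. Qed.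

(** Restoring positive signs does not decrease the form, and since [m <= M], neither does swapping
    back a point with [y i < x i]. What remains is to exclude or identify the points where equality
    occurs. *)
Let max_vertex (M m B : R) X Y :
    0 < M -> 0 <= m <= M ->
    (forall X Y, polygon X Y -> M * X + m * Y <= B) ->
    polygon X Y -> M * X + m * Y = B ->
  exists i, [/\ (1 <= i <= k.+1)%N, X = x i & Y = y i].
Proof.
move=> M0 /andP[m0 mM] ub [s [t [i [ik XY]]]] XYB; exists i.
have xi := x_ge75 _ ik; have yi := y_ge0 _ ik.
have fi := ub _ _ (polygon_vertex _ ik).
have straight (s' t' : bool) :
    M * ((-1) ^+ s' * x i) + m * ((-1) ^+ t' * y i) = B ->
    (-1) ^+ s' * x i = x i /\ (-1) ^+ t' * y i = y i.
  move=> E; have Mx : 0 < M * x i by rewrite mulr_gt0 //; lra.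
  have my : 0 <= m * y i by rewrite mulr_ge0.
  case: s' E; case: t'; rewrite ?expr0 ?expr1 ?mul1r ?mulN1r => E; split=> //; try lra.
  have my0 : m * y i = 0 by lra.
  suff -> : y i = 0 by rewrite oppr0.
  (* If [m] is 0, the form is a multiple of [X], which is largest on the chain only at the first
     point, where [y] vanishes. *)
  move/eqP: my0; rewrite mulf_eq0 => /orP[/eqP mz|/eqP //].
  have := ub _ _ (polygon_vertex 1%N isT).
  case/andP: ik => + ik; rewrite leq_eqVlt => /predU1P[<- _|i1].
    by case: (adm_first adm).
  have : x i < x 1%N by apply: x_decr; rewrite ?i1.
  rewrite -(ltr_pM2l M0) => xx; rewrite mz in XYB E fi *; lra.
case: XY XYB => -[-> ->] XYB; first by have [] := straight _ _ XYB.
(* A swapped point can only be the diagonal point (75, 75), which is its own swap. *)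
suff ik1 : i = k.+1.
  move: XYB straight; have [xk yk] := adm_last adm; rewrite ik1 xk yk.
  by move=> E /(_ _ _ E) [? ?]; split; rewrite ?leqnn.
apply/eqP; rewrite eqn_leq; case/andP: (ik) => i1 ->; rewrite ltnNge /=.
apply/negP => ik'; have ik0 : (1 <= i <= k)%N by rewrite i1.
have yx := y_lt_x _ ik0.
have le : M * ((-1) ^+ s * y i) + m * ((-1) ^+ t * x i) <= M * y i + m * x i.
  have yM : 0 <= M * y i by rewrite mulr_ge0 // ltW.
  have xm : 0 <= m * x i by rewrite mulr_ge0 //; lra.
  by case: (s); case: (t); rewrite ?expr0 ?expr1 ?mul1r ?mulN1r; lra.
have Mm : M = m.
  apply/eqP; rewrite eq_le mM andbT leNgt; apply/negP => mM'.
  have : 0 < (M - m) * (x i - y i) by rewrite mulr_gt0 ?subr_gt0.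
  by lra.
(* With [M = m] the form is a multiple of [X + Y], and the next point of the chain exceeds the
   bound. *)
have := ub _ _ (polygon_vertex i.+1 ltac:(by rewrite ltnS)).
have := slopeE _ ik0; have := slope_lt1 _ ik0.
have [_ yS] := adm_mono adm ik0.
move=> s1 sE; have : 0 < M * ((1 - slope i) * (y i.+1 - y i)).
  by rewrite !mulr_gt0 ?subr_gt0.
have : M * (x i - x i.+1) = M * (slope i * (y i.+1 - y i)) by rewrite sE.
rewrite -Mm in le XYB *; lra.
Qed.

(** Were there a chain point strictly between two maximizers, leaving the first would give
    [m <= M * slope i] and arriving at the second [M * slope (j - 1) <= m], against the strict
    growth of the slopes. *)
Let max_adjacent (M m B : R) i j :
    0 < M -> (forall X Y, polygon X Y -> M * X + m * Y <= B) ->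
    (1 <= i)%N -> (i < j <= k.+1)%N ->
    M * x i + m * y i = B -> M * x j + m * y j = B -> j = i.+1.
Proof.
move=> M0 ub i1 /andP[ij jk] fi fj; apply/eqP; rewrite eqn_leq ij andbT.
case: j ij jk fj => // j ij jk fj; rewrite ltnS leqNgt; apply/negP => lt_ij.
have j1 : (1 <= j)%N by apply: leq_trans i1 _.
have ik : (1 <= i <= k)%N by rewrite i1 (leq_trans (ltnW lt_ij)).
have jk' : (1 <= j <= k)%N by rewrite j1.
have st : slope i < slope j by apply: slope_incr; rewrite ?lt_ij.
have fi' := ub _ _ (polygon_vertex i.+1 ltac:(by case/andP: ik => _; rewrite ltnS)).
have fj' := ub _ _ (polygon_vertex j ltac:(by rewrite j1 ltnW)).
have [_ yi] := adm_mono adm ik; have [_ yj] := adm_mono adm jk'.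
have si : 0 <= (M * slope i - m) * (y i.+1 - y i).
  have : M * (x i - x i.+1) = M * (slope i * (y i.+1 - y i)) by rewrite slopeE.
  by lra.
have sj : 0 <= (m - M * slope j) * (y j.+1 - y j).
  have : M * (x j - x j.+1) = M * (slope j * (y j.+1 - y j)) by rewrite slopeE.
  by lra.
rewrite pmulr_lge0 ?subr_gt0 // in si; rewrite pmulr_lge0 ?subr_gt0 // in sj.
by move: st; rewrite -(ltr_pM2l M0); lra.
Qed.

Definition chain_image (s t r : bool) (i : nat) : R * R :=
  ((-1) ^+ s * (if r then y i else x i), (-1) ^+ t * (if r then x i else y i)).

Definition in_chain_edge s t r i X Y :=
  (X, Y) = chain_image s t r i \/ (X, Y) = chain_image s t r i.+1.

(** The symmetries of the polygon reduce the claim to [0 <= d <= c]. Then all maximizers lie on the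
    chain itself, and any two of them are consecutive. *)
Lemma polygon_edge (c d B : R) :
    (c != 0) || (d != 0) ->
    (forall X Y, polygon X Y -> c * X + d * Y <= B) ->
  exists s t r i, (1 <= i <= k)%N /\
    forall X Y, polygon X Y -> c * X + d * Y = B -> in_chain_edge s t r i X Y.
Proof.
wlog cd : c d / `|d| <= `|c|.
  move=> W; case: (lerP `|d| `|c|) => [|/ltW dc]; first exact: W.
  rewrite orbC => /(W _ _ dc) {}W ub.
  have [X Y XY|s [t [r [i [ik H]]]]] := W.
    by rewrite addrC; apply/ub/polygonS.
  exists t, s, (~~ r), i; split=> // X Y XY E.
  have := H Y X (polygonS _ _ XY); rewrite addrC => /(_ E).
  rewrite /in_chain_edge /chain_image.
  by case: (r) => -[] [-> ->]; [left|right|left|right].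
wlog c0 : c cd / 0 <= c.
  move=> W; case: (lerP 0 c) => [|/ltW c0]; first exact: W.
  rewrite -oppr_eq0 => nz ub.
  have [||//|X Y /polygonN /ub|s [t [r [i [ik H]]]]] := W (- c);
    rewrite ?normrN ?oppr_ge0 //.
    by rewrite mulrN mulNr.
  exists (~~ s), t, r, i; split=> // X Y XY E.
  have := H (- X) Y (polygonN _ _ XY); rewrite mulrNN => /(_ E).
  rewrite /in_chain_edge /chain_image signrN.
  by case=> -[XE ->]; [left|right]; rewrite mulNr -XE opprK.
wlog d0 : d cd / 0 <= d.
  move=> W; case: (lerP 0 d) => [|/ltW d0]; first exact: W.
  rewrite -[d == 0]oppr_eq0 => nz ub.
  have [||//|X Y /polygonS/polygonN/polygonS /ub|s [t [r [i [ik H]]]]] := W (- d);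
    rewrite ?normrN ?oppr_ge0 //.
    by rewrite mulrN mulNr.
  exists s, (~~ t), r, i; split=> // X Y XY E.
  have := H X (- Y) (polygonS _ _ (polygonN _ _ (polygonS _ _ XY))).
  rewrite mulrNN => /(_ E).
  rewrite /in_chain_edge /chain_image signrN.
  by case=> -[-> YE]; [left|right]; rewrite mulNr -YE opprK.
rewrite !ger0_norm // in cd => nz ub.
have c_gt0 : 0 < c.
  rewrite lt_neqAle c0 eq_sym andbT; apply/negP => /eqP cz; move: nz.
  by rewrite cz eqxx /= => /negP; apply; rewrite eq_le d0 -cz cd.
have mx X Y := max_vertex c d B X Y c_gt0 ltac:(by rewrite d0) ub.
pose act i := (1 <= i <= k.+1)%N && (c * x i + d * y i == B).
suff [i [ik H]] : exists i, (1 <= i <= k)%N /\ forall j, act j -> j = i \/ j = i.+1.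
  exists false, false, false, i; split=> // X Y XY E.
  have [j [jk XE YE]] := mx _ _ XY E; rewrite /in_chain_edge /chain_image !mul1r.
  have aj : act j by rewrite /act jk -XE -YE E eqxx.
  by rewrite XE YE; case: (H _ aj) => ->; [left|right].
have adj i j : act i -> act j -> (i < j)%N -> j = i.+1.
  move=> /andP[/andP[i1 _] /eqP fi] /andP[/andP[_ jk] /eqP fj] ij.
  by apply: max_adjacent c_gt0 ub i1 _ fi fj; rewrite ij.
(* The least active index up to [k] starts the edge. If there is none, only [k.+1] can be active,
   and the last edge serves. *)
case: (boolP [exists i : 'I_k.+1, act i]) => [ex|/existsPn none]; last first.
  exists k; split; first by rewrite k_ge1 /=.
  move=> j aj; right; have /andP[/andP[_]] := aj.
  rewrite leq_eqVlt => /predU1P[//|jk _].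
  by have := none (Ordinal jk); rewrite /= aj.
have ex' : exists i, act i && (i <= k)%N.
  by case/existsP: ex => i ai; exists i; rewrite ai -ltnS ltn_ord.
case: (ex_minnP ex') => i /andP[ai ik] imin; exists i; split.
  by case/andP: ai => /andP[->].
move=> j aj; case: (ltngtP i j) => [ij|ji|->]; [right; exact: adj| |by left].
have jk : (j <= k)%N by apply: leq_trans (ltnW ji) ik.
by have := imin j; rewrite aj jk leqNgt ji => /(_ isT).
Qed.

End Chain.

(** * Vertices of the drum *)

Section Vertices.
Context {R : realType}.
Implicit Types (v u : 'rV[R]_5) (a b c d e : R).

Lemma vec5_crd v : v = vec5 (crd v 1) (crd v 2) (crd v 3) (crd v 4) (crd v 5).
Proof.
apply/rowP => j; rewrite !mxE /crd.
by case: j; do 5?[case]; move=> //= h; congr (v 0 _); apply: val_inj; rewrite /= inordK.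
Qed.

Lemma crd_vec5 a b c d e :
  ((crd (vec5 a b c d e) 1 = a) * (crd (vec5 a b c d e) 2 = b) *
   (crd (vec5 a b c d e) 3 = c) * (crd (vec5 a b c d e) 4 = d) *
   (crd (vec5 a b c d e) 5 = e))%type.
Proof. by rewrite /crd !mxE !inordK. Qed.

Lemma tau_vec5 a b c d e : tau (vec5 a b c d e) = vec5 d c a b (- e).
Proof. by rewrite /tau !crd_vec5. Qed.

Lemma eps_vec5 a b c d e :
  ((eps 1 (vec5 a b c d e) = vec5 (- a) b c d e) *
   (eps 2 (vec5 a b c d e) = vec5 a (- b) c d e) *
   (eps 3 (vec5 a b c d e) = vec5 a b (- c) d e) *
   (eps 4 (vec5 a b c d e) = vec5 a b c (- d) e))%type.
Proof.
by do !split; apply/rowP; case; do 5?[case]; move=> //= h; rewrite !mxE.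
Qed.

Lemma vec5D a b c d e a' b' c' d' e' :
  vec5 a b c d e + vec5 a' b' c' d' e' =
  vec5 (a + a') (b + b') (c + c') (d + d') (e + e').
Proof. by apply/rowP; case; do 5?[case]; move=> //= h; rewrite !mxE. Qed.

Lemma vec5Z l a b c d e :
  l *: vec5 a b c d e = vec5 (l * a) (l * b) (l * c) (l * d) (l * e).
Proof. by apply/rowP; case; do 5?[case]; move=> //= h; rewrite !mxE. Qed.

Lemma vec5B a b c d e a' b' c' d' e' :
  vec5 a b c d e - vec5 a' b' c' d' e' =
  vec5 (a - a') (b - b') (c - c') (d - d') (e - e').
Proof. by apply/rowP; case; do 5?[case]; move=> //= h; rewrite !mxE. Qed.

Lemma dot_vec5 a b c d e a' b' c' d' e' :
  dot (vec5 a b c d e) (vec5 a' b' c' d' e') =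
  a * a' + b * b' + c * c' + d * d' + e * e'.
Proof. by rewrite /dot !big_ord_recl big_ord0 !mxE /=; ring. Qed.

(** The adjoint of [tau]: an inequality on the lower skin becomes one on the upper skin for a
    permuted normal, so one analysis serves both skins. *)
Lemma dot_tau a b c d e v :
  dot (vec5 a b c d e) (tau v) = dot (vec5 c d b a (- e)) v.
Proof. by rewrite (vec5_crd v) tau_vec5 !dot_vec5; ring. Qed.

Lemma dot_crd5 e v : dot (vec5 0 0 0 0 e) v = e * crd v 5.
Proof. by rewrite {1}(vec5_crd v) dot_vec5; ring. Qed.

Lemma tauK4 v : tau (tau (tau (tau v))) = v.
Proof. by rewrite /tau !crd_vec5 !opprK -vec5_crd. Qed.

Lemma epsK j v : eps j (eps j v) = v.
Proof. by apply/rowP => i; rewrite !mxE; case: eqP => _; rewrite ?opprK. Qed.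

Lemma sigma_vec5 a b c d e : sigma (vec5 a b c d e) = vec5 b a d c e.
Proof. by rewrite /sigma /tau !crd_vec5 opprK. Qed.

Definition epsb j (s : bool) : 'rV[R]_5 -> 'rV[R]_5 := if s then eps j else id.

Lemma epsb_vec5 (s : bool) a b c d e :
  ((epsb 1 s (vec5 a b c d e) = vec5 ((-1) ^+ s * a) b c d e) *
   (epsb 2 s (vec5 a b c d e) = vec5 a ((-1) ^+ s * b) c d e) *
   (epsb 3 s (vec5 a b c d e) = vec5 a b ((-1) ^+ s * c) d e) *
   (epsb 4 s (vec5 a b c d e) = vec5 a b c ((-1) ^+ s * d) e))%type.
Proof. by case: s; rewrite /= ?eps_vec5 ?expr0 ?expr1 ?mul1r ?mulN1r. Qed.

Lemma Gamma_plus_epsb j s : (1 <= j <= 4)%N -> Gamma_plus (epsb j s).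
Proof.
move=> j4; case: s; last exact: generated_id.
by apply: generated_in; right; exists j.
Qed.

Lemma Gamma_plus_sigma (r : bool) : Gamma_plus (if r then @sigma R else id).
Proof. by case: r; [apply: generated_in; left|apply: generated_id]. Qed.

Lemma Gamma_plus_sub : @Gamma_plus R `<=` @Gamma R.
Proof.
move=> f; elim=> {f} [f [->|sf]||f g _ Gf _ Gg|f g _ Gf fK gK].
- have tG : Gamma (@tau R) by apply: generated_in; left.
  exact: (generated_comp tG tG).
- by apply: generated_in; right.
- exact: generated_id.
- exact: generated_comp.
- exact: generated_inv Gf fK gK.
Qed.

(** * The generating points of the drum in coordinates *)

Context {k : nat} {x y : nat -> R}.
Notation polygon := (@polygon R k x y).

(** The orbit of the base points under [Gamma_plus], all at height 1; [tau] carries it to height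
    -1. *)
Inductive top : 'rV[R]_5 -> Prop :=
| top_m (s t : bool) : top (vec5 0 0 ((-1) ^+ s * 3) ((-1) ^+ t * 3) 1)
| top_p1 (s t : bool) : top (vec5 ((-1) ^+ s * 98) 0 ((-1) ^+ t) 0 1)
| top_p2 (s t : bool) : top (vec5 0 ((-1) ^+ s * 98) 0 ((-1) ^+ t) 1)
| top_a X Y : polygon X Y -> top (vec5 X Y 0 0 1).

Definition vertices : set 'rV[R]_5 :=
  [set v | top v \/ exists2 u, top u & v = tau u].

Lemma top_eps j v : (1 <= j <= 4)%N -> top v -> top (eps j v).
Proof.
have sN (s : bool) : - (-1) ^+ s = (-1) ^+ (~~ s) :> R by rewrite signrN.
have pN X Y : polygon X Y -> polygon X (- Y).
  by move/polygonS/polygonN/polygonS.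
case: j => [|[|[|[|[|//]]]]] // _ [] *;
  rewrite eps_vec5 ?oppr0 -?mulNr ?sN; try by constructor.
- by apply: top_a; apply: polygonN.
- by apply: top_a; apply: pN.
Qed.

Lemma top_sigma v : top v -> top (sigma v).
Proof.
by case=> *; rewrite sigma_vec5; constructor; apply: polygonS.
Qed.

(** [tau] permutes the first four coordinates, so it normalizes the group of sign changes. *)
Lemma eps_tau j v : (1 <= j <= 4)%N ->
  exists2 i, (1 <= i <= 4)%N & eps j (tau v) = tau (eps i v).
Proof.
rewrite (vec5_crd v); case: j => [|[|[|[|[|//]]]]] // _;
  [exists 4|exists 3|exists 1|exists 2] => //; by rewrite !(tau_vec5, eps_vec5).
Qed.

Lemma vertices_eps j v : (1 <= j <= 4)%N -> vertices v -> vertices (eps j v).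
Proof.
move=> j4 [tv|[u tu ->]]; first by left; apply: top_eps.
have [i i4 ->] := eps_tau _ u j4.
by right; exists (eps i u) => //; apply: top_eps.
Qed.

Lemma vertices_tau v : vertices v -> vertices (tau v).
Proof. by move=> [tv|[u tu ->]]; [right; exists v|left; apply: top_sigma]. Qed.

(** Stated as an equivalence so that the induction passes through inverses. *)
Lemma vertices_Gamma f : Gamma f -> forall v, vertices v <-> vertices (f v).
Proof.
elim=> {f} [f [->|[j j4 <-]]||f g _ Gf _ Gg|f g _ Gf fK gK] v.
- split; first exact: vertices_tau.
  (* The inverse of [tau] is its cube. *)
  by rewrite -{2}[v]tauK4; do 3!move/vertices_tau.
- split; first exact: vertices_eps.
  by rewrite -{2}[v](epsK j); apply: vertices_eps.
- by [].
- by rewrite /= -Gf; apply: Gg.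
- by rewrite (Gf (g v)) gK.
Qed.

Lemma base_top v : base_points k x y v -> top v.
Proof.
case=> [[s [t ->]]|[[s ->]|[i ik ->]]]; first exact: top_m.
  by rewrite /pt_p -[98]mul1r; apply: (top_p1 false).
exact/top_a/polygon_vertex.
Qed.

Lemma top_orbit v : top v ->
  exists2 g, Gamma_plus g & exists2 u, base_points k x y u & v = g u.
Proof.
have ba i : (1 <= i <= k.+1)%N -> base_points k x y (pt_a x y i).
  by right; right; exists i.
have bp s : base_points k x y (pt_p R s) by right; left; exists s.
have gg (j l : nat) (s t r : bool) : (1 <= j <= 4)%N -> (1 <= l <= 4)%N ->
    Gamma_plus (epsb j s \o (epsb l t \o (if r then @sigma R else id))).
  move=> j4 l4; apply: generated_comp; first exact: Gamma_plus_epsb.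
  by apply: generated_comp; [exact: Gamma_plus_epsb|exact: Gamma_plus_sigma].
case=> [s t|s t|s t|X Y [s [t [i [ik [[-> ->]|[-> ->]]]]]]].
- exists id; first exact: generated_id.
  by exists (pt_m R s t) => //; left; exists s, t.
- exists (epsb 1 s \o (epsb 2 false \o id)); first exact: (gg _ _ _ _ false).
  by exists (pt_p R t) => //=; rewrite /pt_p epsb_vec5.
- exists (epsb 2 s \o (epsb 1 false \o @sigma R)); first exact: (gg _ _ _ _ true).
  by exists (pt_p R t) => //=; rewrite /pt_p sigma_vec5 epsb_vec5.
- exists (epsb 1 s \o (epsb 2 t \o id)); first exact: (gg _ _ _ _ false).
  by exists (pt_a x y i); [exact: ba|rewrite /= /pt_a !epsb_vec5].
- exists (epsb 1 s \o (epsb 2 t \o @sigma R)); first exact: (gg _ _ _ _ true).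
  by exists (pt_a x y i); [exact: ba|rewrite /= /pt_a sigma_vec5 !epsb_vec5].
Qed.

Lemma drumE : drum k x y = conv vertices.
Proof.
rewrite /drum; congr conv; apply/seteqP; split=> v.
- case=> g Gg [u bu <-]; apply/(vertices_Gamma _ Gg u).
  by left; apply: base_top.
- case=> [/top_orbit [g Gg [u bu ->]]|[w /top_orbit [g Gg [u bu ->]] ->]].
    by exists g; [apply: Gamma_plus_sub|exists u].
  exists (@tau R \o g); last by exists u.
  by apply: generated_comp; [apply: generated_in; left|apply: Gamma_plus_sub].
Qed.

Lemma top_crd5 v : top v -> crd v 5 = 1.
Proof. by case=> *; rewrite crd_vec5. Qed.

Lemma tau_crd5 v : crd (tau v) 5 = - crd v 5.
Proof. by rewrite /tau crd_vec5. Qed.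

Lemma sg_le (s : bool) a : a * (-1) ^+ s <= `|a|.
Proof.
by case: s; rewrite ?expr1 ?expr0 ?mulrN1 ?mulr1 ?ler_norm // -normrN ler_norm.
Qed.

Lemma sg_norm a : exists s : bool, a * (-1) ^+ s = `|a|.
Proof.
have [a0|a0] := leP 0 a; [exists false|exists true].
  by rewrite expr0 mulr1 ger0_norm.
by rewrite expr1 mulrN1 ltr0_norm.
Qed.

End Vertices.

(** * Facets meeting the lower skin in an edge *)

Section LinearImages.
Context {R : realType} {n : nat}.
Implicit Types (A : set 'rV[R]_n) (f : 'rV[R]_n -> 'rV[R]_n).

Lemma image_conv f A : linear f -> f @` conv A = conv (f @` A).
Proof.
move=> fL; have f0 : f 0 = 0.
  by rewrite -[X in f X](subrr 0) -scaleN1r addrC fL scaleN1r addNr.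
have fsum N (w : 'I_N -> R) (p : 'I_N -> 'rV[R]_n) :
    f (\sum_i w i *: p i) = \sum_i w i *: f (p i).
  by elim/big_rec2: _ => [//|i u v _ <-]; rewrite fL.
apply/seteqP; split=> v.
- case=> _ [N [w [p [Ap w0 w1 ->]]]] <-; exists N, w, (f \o p); split=> //.
  by move=> i; exists (p i).
- case=> N [w [p [Ap w0 w1 ->]]].
  have pre i : exists u, A u /\ f u = p i by case: (Ap i) => u; exists u.
  have [q qP] := choice pre.
  exists (\sum_i w i *: q i); last first.
    by rewrite fsum; apply: eq_bigr => i _; case: (qP i) => _ ->.
  by exists N, w, q; split=> // i; case: (qP i).
Qed.

Lemma has_dim_diff A d : has_dim A d ->
  exists2 U : {vspace 'rV[R]_n}, \dim U = d & forall u v, A u -> A v -> u - v \in U.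
Proof.
case=> p [U [AU dU]]; exists U => // u v /sub_aff + /sub_aff; rewrite AU => uU vU.
by rewrite -(subrKA p) rpredD // -opprB rpredN.
Qed.

Lemma dim1_collinear A u v w : has_dim A 1 -> A u -> A v -> A w -> v != u ->
  exists l, w - u = l *: (v - u).
Proof.
move=> /has_dim_diff[U dU inU] Au Av Aw vu; apply/vlineP.
suff -> : <[v - u]>%VS = U by apply: inU.
by apply/eqP; rewrite eqEdim -memvE inU // dU dim_vline subr_eq0 vu.
Qed.

End LinearImages.

(** * Inequalities satisfied by the normal of a facet *)

Section Facets.
Context {R : realType} {k : nat} {x y : nat -> R}.
Hypothesis k_ge1 : (1 <= k)%N.
Hypothesis adm : admissible k x y.

Notation polygon := (@polygon R k x y).
Notation top := (@top R k x y).
Notation vertices := (@vertices R k x y).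

Lemma polygon_first (s : bool) : polygon ((-1) ^+ s * 100) 0.
Proof.
have [x1 y1] := adm_first adm; exists s, false, 1%N; split=> //; left.
by rewrite x1 y1 mulr0.
Qed.

Lemma polygon_last (s t : bool) :
  polygon ((-1) ^+ s * 75) ((-1) ^+ t * 75).
Proof.
have [xk yk] := adm_last adm; exists s, t, k.+1; split; first by rewrite leqnn.
by left; rewrite xk yk.
Qed.

(** Each inequality tests an orbit at the point whose signs match those of the coefficients: those
    of a_1 and a_(k+1) in the first group, those of the p's and m's in the second. *)
Lemma top_bounds (c1 c2 c3 c4 c5 b : R) :
  (forall u, top u -> dot (vec5 c1 c2 c3 c4 c5) u <= b) ->
  [/\ 100 * `|c1| + c5 <= b, 100 * `|c2| + c5 <= b
    & 75 * (`|c1| + `|c2|) + c5 <= b] /\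
  [/\ 98 * `|c1| + `|c3| + c5 <= b, 98 * `|c2| + `|c4| + c5 <= b
    & 3 * (`|c3| + `|c4|) + c5 <= b].
Proof.
move=> ub.
have [s1 <-] := sg_norm c1; have [s2 <-] := sg_norm c2.
have [s3 <-] := sg_norm c3; have [s4 <-] := sg_norm c4.
have h1 := ub _ (top_a _ _ (polygon_first s1)).
have h2 := ub _ (top_a _ _ (polygonS _ _ (polygon_first s2))).
have h3 := ub _ (top_a _ _ (polygon_last s1 s2)).
have h4 := ub _ (top_p1 s1 s3); have h5 := ub _ (top_p2 s2 s4).
have h6 := ub _ (top_m s3 s4).
rewrite !dot_vec5 in h1 h2 h3 h4 h5 h6.
move: ((-1) ^+ s1) ((-1) ^+ s2) ((-1) ^+ s3) ((-1) ^+ s4) h1 h2 h3 h4 h5 h6.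
by move=> e1 e2 e3 e4 *; do !split; lra.
Qed.

(** Some p- or m-point reaches the bound [b], expressed through the best choice of signs so that
    only absolute values occur. *)
Definition off_polygon (c1 c2 c3 c4 c5 b : R) :=
  [\/ b <= 98 * `|c1| + `|c3| + c5, b <= 98 * `|c2| + `|c4| + c5
    | b <= 3 * (`|c3| + `|c4|) + c5].

Lemma top_active (c1 c2 c3 c4 c5 b : R) u :
    top u -> dot (vec5 c1 c2 c3 c4 c5) u = b ->
  off_polygon c1 c2 c3 c4 c5 b \/
  exists X Y, [/\ polygon X Y,
    u = vec5 X Y 0 0 1 & c1 * X + c2 * Y + c5 = b].
Proof.
case=> [s t|s t|s t|X Y XY]; rewrite dot_vec5 => E; [left|left|left|right].
- by apply: Or33; have := sg_le s c3; have := sg_le t c4; lra.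
- by apply: Or31; have := sg_le s c1; have := sg_le t c3; lra.
- by apply: Or32; have := sg_le s c2; have := sg_le t c4; lra.
- by exists X, Y; split=> //; rewrite -E; ring.
Qed.

Section Normal.
Variables (c1 c2 c3 c4 c5 b : R).
Let c := vec5 c1 c2 c3 c4 c5.
Hypothesis ub : forall u, vertices u -> dot c u <= b.

Let ub_top u : top u -> dot c u <= b.
Proof. by move=> tu; apply: ub; left. Qed.

Let ub_bot u : top u -> dot (vec5 c3 c4 c2 c1 (- c5)) u <= b.
Proof. by move=> tu; rewrite -dot_tau; apply: ub; right; exists u. Qed.

Ltac bounds := have [[? ? ?] [? ? ?]] := top_bounds _ _ _ _ _ _ ub_top;
  have [[? ? ?] [? ? ?]] := top_bounds _ _ _ _ _ _ ub_bot;
  have ? := normr_ge0 c1; have ? := normr_ge0 c2;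
  have ? := normr_ge0 c3; have ? := normr_ge0 c4.

(** Comparing the active p- or m-point with a_1 and a_(k+1) gives
    [|c1| + |c2| <= 2/3 * (|c3| + |c4|)] from the upper skin in all three cases, and the reverse
    estimate from the lower skin. Together they force all four to vanish. *)
Lemma off_polygon_excl :
    off_polygon c1 c2 c3 c4 c5 b -> off_polygon c3 c4 c2 c1 (- c5) b ->
  `|c1| + `|c2| + `|c3| + `|c4| <= 0.
Proof. by bounds; case=> ?; case=> ?; lra. Qed.

(** The lower estimate [|c3| + |c4| <= 2/3 * (|c1| + |c2|)] alone suffices here. *)
Lemma off_polygon_top0 :
    off_polygon c3 c4 c2 c1 (- c5) b -> c1 = 0 -> c2 = 0 ->
  `|c1| + `|c2| + `|c3| + `|c4| <= 0.
Proof.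
move=> off c10 c20; have n1 : `|c1| = 0 by rewrite c10 normr0.
have n2 : `|c2| = 0 by rewrite c20 normr0.
by bounds; case: off => ?; lra.
Qed.


Definition active : set 'rV[R]_5 := vertices `&` [set u | dot c u = b].
Definition lower_active : set 'rV[R]_5 := active `&` [set u | crd u 5 = -1].

Let F := conv vertices `&` [set v | dot c v = b].
Let E := F `&` (conv vertices `&` [set v | crd v 5 = -1]).

Lemma facet_active : F `<=` conv active.
Proof. by move=> v [vV vb]; apply: conv_face. Qed.

Lemma vertices_crd5 u : vertices u -> -1 <= crd u 5.
Proof.
case=> [/top_crd5 ->|[w /top_crd5 w5 ->]]; last by rewrite tau_crd5 w5.
by lra.
Qed.

(** Within [F], the lower skin is where the form [- v_5] attains its bound 1, so [conv_face] applies
    a second time. *)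
Lemma edgeE_conv : E = conv lower_active.
Proof.
apply/seteqP; split=> v.
- case=> vF [_ v5]; have := facet_active _ vF.
  have low u : active u -> dot (vec5 0 0 0 0 (-1)) u <= 1.
    by case=> /vertices_crd5 + _; rewrite dot_crd5; lra.
  move=> /(conv_face _ _ _ _ low) vL.
  apply: (conv_mono _ _ _ _ (vL _)); last by rewrite dot_crd5 v5; lra.
  by move=> u [au /=]; rewrite dot_crd5 => u5; split=> //=; lra.
- move=> vL; have vV : conv vertices v.
    by apply: conv_mono vL => u [[]].
  split; split=> //=.
  + by apply: conv_dot_eq vL => u [[]].
  + have : dot (vec5 0 0 0 0 1) v = -1.
      by apply: conv_dot_eq vL => u [_ /= u5]; rewrite dot_crd5 u5 mul1r.
    by rewrite dot_crd5 mul1r.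
Qed.

Lemma lower_active_tau u : lower_active u ->
  exists w, [/\ top w, u = tau w & dot (vec5 c3 c4 c2 c1 (- c5)) w = b].
Proof.
case=> -[[/top_crd5 u5|[w tw ->]] ub'] /= u5'.
  by move: u5'; rewrite u5; lra.
by exists w; split=> //; rewrite -dot_tau.
Qed.

Lemma tau_lower_active w : top w ->
  dot (vec5 c3 c4 c2 c1 (- c5)) w = b -> lower_active (tau w).
Proof.
move=> tw wb; split; last by rewrite /= tau_crd5 (top_crd5 _ tw).
by split; [right; exists w|rewrite /= dot_tau].
Qed.

Hypothesis dimE : has_dim E 1.

Lemma lower_active_ex : exists u, lower_active u.
Proof.
apply: contrapT => none; apply: (dim1_not_sub1 _ 0 dimE); rewrite edgeE_conv.
move=> v [N [w [p [pP w0 w1 _]]]]; case: N w p pP w0 w1 => [|N] w p pP w0 w1.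
  by move: w1; rewrite big_ord0 => /eqP; rewrite eq_sym oner_eq0.
by case: none; exists (p ord0).
Qed.

(** Otherwise the form depends on the height only, every lower vertex is active, and [E] contains
    three points that are not collinear. *)
Lemma normal_neq0 : 0 < `|c1| + `|c2| + `|c3| + `|c4|.
Proof.
rewrite ltNge; apply/negP => le0.
have [z1 z2 z3 z4] : [/\ c1 = 0, c2 = 0, c3 = 0 & c4 = 0].
  have ? := normr_ge0 c1; have ? := normr_ge0 c2.
  have ? := normr_ge0 c3; have ? := normr_ge0 c4.
  by split; apply/eqP; rewrite -normr_eq0; apply/eqP; lra.
have dotw w : top w -> dot (vec5 c3 c4 c2 c1 (- c5)) w = - c5.
  by move=> /top_crd5 w5; rewrite z1 z2 z3 z4 dot_crd5 w5 mulr1.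
have bE : b = - c5.
  by have [u /lower_active_tau[w [tw _ <-]]] := lower_active_ex; apply: dotw.
have inE X Y : polygon X Y -> E (vec5 0 0 X Y (-1)).
  move=> XY; rewrite edgeE_conv; apply: sub_conv.
  have tw := top_a _ _ XY; rewrite -tau_vec5.
  by apply: tau_lower_active; rewrite // bE; apply: dotw.
have P1 := inE _ _ (polygon_first false).
have P2 := inE _ _ (polygon_first true).
have P3 := inE _ _ (polygonS _ _ (polygon_first false)).
have [|l] := dim1_collinear _ _ _ _ dimE P1 P2 P3.
  apply/eqP => /(congr1 (fun v => crd v 3)); rewrite !crd_vec5 expr0 expr1; lra.
rewrite !vec5B vec5Z => /(congr1 (fun v => crd v 4)); rewrite !crd_vec5.
by rewrite expr0; lra.
Qed.

(* Otherwise the upper part of [F] is contained in a line of the plane of the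
   polygon, and [F] in the join of that line with the edge [E]. *)
Lemma lower_on_polygon d : has_dim F d -> (3 < d)%N ->
  ~ off_polygon c3 c4 c2 c1 (- c5) b.
Proof.
move=> dimF d3 off.
(* Since a p- or m-point is active below, none is active above: the active upper vertices are
   a-points on one line. *)
have upper v : active v -> top v -> exists X Y,
    v = vec5 X Y 0 0 1 /\ c1 * X + c2 * Y + c5 = b.
  move=> [_ vb] tv; have [up|[X [Y [_ -> XY]]]] := top_active _ _ _ _ _ _ _ tv vb.
    by have := off_polygon_excl up off; have := normal_neq0; lra.
  by exists X, Y.
have c12 : c1 ^+ 2 + c2 ^+ 2 != 0.
  rewrite paddr_eq0 ?sqr_ge0 // !sqrf_eq0; apply/negP => /andP[/eqP z1 /eqP z2].
  by have := off_polygon_top0 off z1 z2; have := normal_neq0; lra.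
have [p [U [EU dU]]] := dimE.
pose l := vec5 (- c2) c1 0 0 0.
have [q qP] : exists q, forall v, active v -> top v -> v - q \in <[l]>%VS.
  case: (pselect (exists q, active q /\ top q)) => [[q [aq tq]]|none]; last first.
    (* Without active upper vertices any [q] will do. *)
    by exists 0 => v av tv; case: none; exists v.
  exists q => v av tv; apply/vlineP.
  have [X [Y [-> XY]]] := upper v av tv; have [X0 [Y0 [-> XY0]]] := upper q aq tq.
  (* The coefficient of the orthogonal projection of the difference onto [l]. *)
  exists (((Y - Y0) * c1 - (X - X0) * c2) / (c1 ^+ 2 + c2 ^+ 2)).
  rewrite vec5B vec5Z; congr vec5; try ring.
  - have cX : c1 * (X - X0) = - (c2 * (Y - Y0)) by lra.
    apply: (mulIf c12); rewrite mulrAC divfK //.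
    have -> : (X - X0) * (c1 ^+ 2 + c2 ^+ 2) =
        c1 * (X - X0) * c1 + (X - X0) * c2 ^+ 2 by ring.
    by rewrite cX; ring.
  - have cY : c2 * (Y - Y0) = - (c1 * (X - X0)) by lra.
    apply: (mulIf c12); rewrite mulrAC divfK //.
    have -> : (Y - Y0) * (c1 ^+ 2 + c2 ^+ 2) =
        c2 * (Y - Y0) * c2 + (Y - Y0) * c1 ^+ 2 by ring.
    by rewrite cY; ring.
(* Directions of the join: one from [E], one along the upper line, and one connecting the two, hence
   dimension at most 3. *)
pose W := (U + (<[q - p]> + <[l]>))%VS.
have dW : (\dim W <= 3)%N.
  apply: leq_trans (dimv_add_leqif _ _) _; rewrite dU ltnS.
  by apply: leq_trans (dimv_add_leqif _ _) _;
    rewrite !dim_vline (@leq_add _ _ 1 1) ?leq_b1.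
suff : (d <= \dim W)%N by move/leq_trans/(_ dW); rewrite leqNgt d3.
apply: (dim_flat_le _ p _ _ dimF) => v /facet_active/conv_sub_aff.
apply: aff_sub_flat => {}v av; have [[tv|[w tw vE]] vb] := av.
  rewrite -(subrKA q); apply: (subvP (addvSr _ _)); rewrite addrC.
  by apply: memv_add; [exact: memv_line|exact: qP].
apply: (subvP (addvSl _ _)).
have : aff E v.
  apply: sub_aff; rewrite edgeE_conv; apply: sub_conv; split=> //=.
  by rewrite vE tau_crd5 (top_crd5 _ tw).
by rewrite EU.
Qed.

(** On the plane of the lower polygon, spanned by coordinates 3 and 4, this is the symmetry encoded
    by [chain_image]. *)
Definition edge_sym (s t r : bool) : 'rV[R]_5 -> 'rV[R]_5 :=
  epsb 3 s \o (epsb 4 t \o (if r then @sigma R else id)).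

Lemma Gamma_plus_edge_sym s t r : Gamma_plus (edge_sym s t r).
Proof.
apply: generated_comp; first exact: Gamma_plus_epsb.
by apply: generated_comp; [exact: Gamma_plus_epsb|exact: Gamma_plus_sigma].
Qed.

Lemma edge_sym_pt_a s t r i : edge_sym s t r (tau (pt_a x y i)) =
  vec5 0 0 (@chain_image R x y s t r i).1 (@chain_image R x y s t r i).2 (-1).
Proof.
rewrite /edge_sym /= /pt_a tau_vec5.
by case: r; rewrite ?sigma_vec5 !epsb_vec5.
Qed.

Lemma tau_linear : linear (@tau R).
Proof.
by move=> a u v; rewrite /tau vec5Z vec5D /crd !mxE mulrN opprD.
Qed.

Lemma eps_linear j : linear (@eps R j).
Proof.
by move=> a u v; apply/rowP => i; rewrite !mxE; case: eqP => _; rewrite ?opprD ?mulrN.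
Qed.

Lemma edge_sym_linear s t r : linear (edge_sym s t r).
Proof.
have epsbL j s' : linear (epsb (R := R) j s') by case: s'; [exact: eps_linear|].
move=> a u v; rewrite /edge_sym /=.
by case: r; rewrite /sigma ?tau_linear !epsbL.
Qed.

(** All active lower vertices are a-points, so [polygon_edge] leaves at most the two ends of one
    edge; the dimension of [E] requires both. *)
Lemma edge_of_normal d : has_dim F d -> (3 < d)%N ->
  exists s t r i, (1 <= i <= k)%N /\
    E = edge_sym s t r @` (@tau R @` conv [set pt_a x y i; pt_a x y i.+1]).
Proof.
move=> dimF d3; have off := lower_on_polygon _ dimF d3.
have lowP u : lower_active u -> exists X Y, [/\ polygon X Y,
    u = vec5 0 0 X Y (-1) & c3 * X + c4 * Y = b + c5].
  move=> /lower_active_tau[w [tw -> wb]].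
  have [//|[X [Y [XY -> XYb]]]] := top_active _ _ _ _ _ _ _ tw wb.
  by exists X, Y; split; rewrite ?tau_vec5 //; lra.
(* If both vanished, [b] would equal [- c5], and the bounds at the lower p-points would make [c1]
   and [c2] vanish too. *)
have c34 : (c3 != 0) || (c4 != 0).
  rewrite -negb_and; apply/negP => /andP[/eqP z3 /eqP z4].
  have [u /lowP[X [Y [_ _]]]] := lower_active_ex.
  rewrite z3 z4 => bE; have := normal_neq0; bounds.
  have n3 : `|c3| = 0 by rewrite z3 normr0.
  have n4 : `|c4| = 0 by rewrite z4 normr0.
  by lra.
have ubP X Y : polygon X Y -> c3 * X + c4 * Y <= b + c5.
  by move=> /(top_a)/ub_bot; rewrite dot_vec5; lra.
have [s [t [r [i [ik edgeP]]]]] := polygon_edge k_ge1 adm _ _ _ c34 ubP.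
exists s, t, r, i; split=> //.
pose q j := edge_sym s t r (tau (pt_a x y j)).
have lowq u : lower_active u -> u = q i \/ u = q i.+1.
  move=> /lowP[X [Y [XY -> XYb]]]; rewrite /q !edge_sym_pt_a.
  by case: (edgeP _ _ XY XYb) => <-; [left|right].
(* If one of the two ends were not active, [E] would be contained in a single point. *)
have two q1 q2 : (forall u, lower_active u -> u = q1 \/ u = q2) -> lower_active q1.
  move=> low12; apply: contrapT => no1; apply: (dim1_not_sub1 _ q2 dimE).
  rewrite edgeE_conv => v vL.
  have : v - q2 \in (0%VS : {vspace 'rV[R]_5}).
    apply: (aff_sub_flat _ _ _ _ _ (conv_sub_aff _ _ vL)) => u uL.
    by case: (low12 _ uL) => uE; rewrite uE ?subrr ?mem0v // uE in uL *.
  by rewrite memv0 subr_eq0 => /eqP.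
have -> : E = conv [set q i; q i.+1].
  rewrite edgeE_conv; congr conv; apply/seteqP; split=> [u /lowq //|u [] ->].
    exact: two lowq.
  by apply: (two _ (q i)) => u' /lowq []; [right|left].
rewrite !image_conv; [|exact: edge_sym_linear|exact: tau_linear].
by rewrite !image_setU !image_set1.
Qed.

End Normal.

(** Differences of opposite a_1-points in the two skins span the first four coordinate directions; a
    difference between the skins adds the fifth. *)
Lemma drum_dim d : has_dim (drum k x y) d -> (4 < d)%N.
Proof.
rewrite drumE => /has_dim_diff[U <- inU].
suff -> : U = fullv by rewrite dimvf dim_matrix.
have inT X Y : polygon X Y -> conv vertices (vec5 X Y 0 0 1).
  by move=> XY; apply: sub_conv; left; apply: top_a.
have inB X Y : polygon X Y -> conv vertices (vec5 0 0 X Y (-1)).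
  move=> XY; apply: sub_conv; right; rewrite -tau_vec5.
  by exists (vec5 X Y 0 0 1) => //; apply: top_a.
have f s := polygon_first s; have f' s := polygonS _ _ (f s).
have u1 := inU _ _ (inT _ _ (f false)) (inT _ _ (f true)).
have u2 := inU _ _ (inT _ _ (f' false)) (inT _ _ (f' true)).
have u3 := inU _ _ (inB _ _ (f false)) (inB _ _ (f true)).
have u4 := inU _ _ (inB _ _ (f' false)) (inB _ _ (f' true)).
have u5 := inU _ _ (inT _ _ (f false)) (inB _ _ (f false)).
apply/vspaceP => v; rewrite memvf (vec5_crd v).
set a1 := crd v 1; set a2 := crd v 2; set a3 := crd v 3; set a4 := crd v 4.
set a5 := crd v 5.
(* The vector of [u5] is (100, 0, -100, 0, 2); taken [a5 / 2] times it contributes [50 * a5] and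
   [-50 * a5] to coordinates 1 and 3, which the multiples of [u1] and [u3] compensate. *)
have := rpredD (rpredZ ((a1 - 50 * a5) / 200) u1) (rpredD (rpredZ (a2 / 200) u2)
  (rpredD (rpredZ ((a3 + 50 * a5) / 200) u3) (rpredD (rpredZ (a4 / 200) u4)
  (rpredZ (a5 / 2) u5)))).
rewrite !vec5B !vec5Z !vec5D expr0 expr1 => uU.
by apply: etrans uU; congr (vec5 _ _ _ _ _ \in U); field.
Qed.

End Facets.

Theorem theorem3p20 (R : realType) (k : nat) (x y : nat -> R)
    (k_ge1 : (1 <= k)%N) (adm : admissible k x y)
    (simp : simplicial_drum k x y)
    (F : set 'rV[R]_5) (facetF : facet (drum k x y) F)
    (F_minus : F <> skin_minus k x y) (F_plus : F <> skin_plus k x y)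
    (edgeE : edge (skin_minus k x y) (F `&` skin_minus k x y)) :
  exists (g : 'rV[R]_5 -> 'rV[R]_5) (i : nat),
    [/\ Gamma_plus g, (1 <= i <= k)%N
      & F `&` skin_minus k x y =
        g @` (@tau R @` conv [set pt_a x y i; pt_a x y i.+1])].
Proof.
have [[c [b [ub FE]]] [d [dimD dimF]]] := facetF.
have d3 := drum_dim adm _ dimD; rewrite ltnS in d3.
case: edgeE => _; rewrite FE /skin_minus drumE in ub *.
rewrite FE drumE in dimF; rewrite (vec5_crd c) in ub dimF * => dimE.
have ubV u : @vertices R k x y u ->
    dot (vec5 (crd c 1) (crd c 2) (crd c 3) (crd c 4) (crd c 5)) u <= b.
  by move=> uV; apply: ub; apply: sub_conv.
have [s [t [r [i [ik ->]]]]] := edge_of_normal k_ge1 adm _ _ _ _ _ _ ubV dimE _ dimF d3.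
by exists (edge_sym s t r), i; split=> //; apply: Gamma_plus_edge_sym.
Qed.
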